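(* Let $\Bbbk$ be a field, $V$ a finite set and $R=\Bbbk[V]$ the polynomial ring whose indeterminates are the elements of $V$. Let $I\subseteq R$ be an ideal generated by monomials of degree $2$, and let $c=\operatorname{ht} I$. Then \[ e(R/I)\leq \frac{T_1T_2\cdots T_c}{c!}. \]
   Context: $R$ is graded with $\deg x=1$ for all $x\in V$. $e(R/I)$ denotes the Hilbert-Samuel multiplicity of $R/I$. If $f_1,\dots,f_m$ are the monomial minimal generators of $I$, then $T_l=T_l(I)$ is the largest twist with which $R$ appears in the $l$-th module of the Taylor resolution of $R/I$, that is, $T_l=\max\{\deg \mathrm{lcm}(f_{s_1},\dots,f_{s_l}) : 1\leq s_1<\cdots<s_l\leq m\}$. *)

(* Defs.v *)
From mathcomp Require Import all_boot all_order all_algebra.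
From mathcomp Require Import ring_quotient.
From mathcomp.multinomials Require Import mpoly.

Set Implicit Arguments.
Unset Strict Implicit.
Unset Printing Implicit Defensive.

Import GRing.Theory.
Local Open Scope ring_scope.

Section CommutativeAlgebra.

Variable A : comNzRingType.
Implicit Types (I P : {pred A}) (J K G : A -> Prop) (f : A).

Definition gen_ideal G f : Prop :=
  exists s : seq (A * A),
    (forall p, p \in s -> G p.2) /\ f = \sum_(p <- s) p.1 * p.2.

Definition add_ideal J K f : Prop :=
  exists g h, [/\ J g, K h & f = g + h].

Definition pow_ideal J (t : nat) : A -> Prop :=
  gen_ideal (fun f =>
    exists g : 'I_t -> A, (forall i, J (g i)) /\ f = \prod_(i < t) g i).

(* [idealr_closed] already includes properness (1 \notin P). *)
Definition prime_ideal P : Prop :=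
  idealr_closed P /\ prime_idealr_closed P.

(* P 0 < P 1 < ... < P l; the values of P beyond l are irrelevant. *)
Definition prime_chain (l : nat) (P : nat -> {pred A}) : Prop :=
  (forall i, (i <= l)%N -> prime_ideal (P i)) /\
  (forall i, (i < l)%N ->
     {subset P i <= P i.+1} /\ ~ {subset P i.+1 <= P i}).

Definition prime_height P (h : nat) : Prop :=
  (exists Q, prime_chain h Q /\ Q h =i P) /\
  (forall l Q, prime_chain l Q -> Q l =i P -> (l <= h)%N).

(* Primes of infinite height cannot realise the minimum, so only finite
   heights are compared. *)
Definition ideal_height I (c : nat) : Prop :=
  (exists P, [/\ prime_ideal P, {subset I <= P} & prime_height P c]) /\
  (forall P h, prime_ideal P -> {subset I <= P} -> prime_height P h ->
     (c <= h)%N).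

(* The primes of A/I are the primes of A containing I. *)
Definition krull_dim_quotient I (d : nat) : Prop :=
  (exists Q, prime_chain d Q /\ {subset I <= Q 0%N}) /\
  (forall l Q, prime_chain l Q -> {subset I <= Q 0%N} -> (l <= d)%N).

End CommutativeAlgebra.

Section PolynomialRing.

Variables (k : fieldType) (n : nat).
Local Notation R := {mpoly k[n]}.
Implicit Types (I : {pred R}) (S G : seq 'X_{1..n}).

(* The classes of b 0, ..., b (h - 1) form a k-basis of R/J. *)
Definition quotient_dim (J : R -> Prop) (h : nat) : Prop :=
  exists b : 'I_h -> R, forall f : R,
    exists! a : {ffun 'I_h -> k}, J (f - \sum_(i < h) a i *: b i).

Definition irrelevant_ideal : R -> Prop :=
  gen_ideal (fun f => exists i : 'I_n, f = 'X_i).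

(* The value at t of the Hilbert-Samuel function of R/I is the length of
   R/(I + m^t), m the irrelevant ideal; this is its dimension over k, since
   R/m = k. *)
Definition hilbert_samuel I (t h : nat) : Prop :=
  quotient_dim
    (add_ideal (fun f => f \in I) (pow_ideal irrelevant_ideal t)) h.

(* e = d! times the coefficient of X^d in the Hilbert-Samuel polynomial of
   R/I, where d = dim R/I. *)
Definition hilbert_samuel_multiplicity I (e : rat) : Prop :=
  exists (d : nat) (p : {poly rat}),
    [/\ krull_dim_quotient I d,
        exists t0 : nat, forall t, (t0 <= t)%N ->
          exists2 h : nat, hilbert_samuel I t h & p.[t%:R] = h%:R
      & e = d`!%:R * p`_d].

Definition generated_by_monomials I S : Prop :=
  forall f, f \in I <->
    gen_ideal (fun g : R => exists2 m, m \in S & g = 'X_[m]) f.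

Definition minimal_monomial_generators I G : Prop :=
  [/\ uniq G, generated_by_monomials I G
    & forall S, {subset S <= G} -> generated_by_monomials I S ->
        {subset G <= S}].

End PolynomialRing.

(* T_l, where G lists the minimal monomial generators: subsets of indices of
   cardinality l stand for s_1 < ... < s_l. *)
Definition taylor_twist (n : nat) (G : seq 'X_{1..n}) (l : nat) : nat :=
  \max_(s : {set 'I_(size G)} | #|s| == l)
     mdeg (\big[@mlcm n/0%MM]_(i in s) nth 0%MM G i).

(* Main.v *)
Require Import Defs.
From mathcomp Require Import all_boot all_order all_algebra.
From mathcomp.multinomials Require Import mpoly.
From mathcomp Require Import ring_quotient zify lra.
From Stdlib Require Import Classical_Prop.

(** The bound splits into a statement about graphs and two comparisons between
    the ideal and a graph.

    Polarization attaches to the generators a graph [E] on the vertices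
    [(i, b)], whose edges are [{(i, false), (j, false)}] for a generator
    [x_i x_j] and [{(i, false), (i, true)}] for [x_i ^ 2].  It turns degrees of
    lcms into numbers of spanned vertices, so [T_l] is the largest number of
    vertices spanned by [l] edges of [E].  The height [c] is the covering
    number of [E], and the multiplicity is at most the number of covers of [E]
    of size [c] ([multiplicity_le_min_covers]).  It remains to prove
    [#|min_covers E c| * c! <= T_1 ... T_c] ([card_min_covers_le]).

    This is by induction on [c].  Counting pairs of a minimum cover and one of
    its vertices [v], and deleting [v] from the graph, bounds [c] times the
    number of minimum covers by [#|W|] times the bound for [c - 1], where [W]
    is the union of all the minimum covers.  The heart of the matter is
    [#|W| <= T_c] ([union_min_covers_le]): given a minimum cover [C], an
    exchange argument verifies Hall's condition for matching [W :\: C] into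
    [C], and the matching edges, completed by one edge at each unmatched vertex
    of [C], are at most [c] edges spanning [W].

    For the multiplicity, the monomials of degree less than [t] outside the
    ideal span the quotient whose dimension is the Hilbert-Samuel function at
    [t].  Such a monomial determines a vertex cover [C] of [E], and those with
    given [C] involve [n - #|C|] variables with free exponents, so that they
    are at most [t ^ (n - #|C|) / (n - #|C|)!] up to terms of lower order in
    [t].  Since polynomials are compared at all large [t], this bounds the
    coefficient of degree [d] of the Hilbert-Samuel polynomial as soon as
    [n - c <= d], which a chain of ideals generated by variables provides.

    For the height, a prime containing the ideal contains the variables of
    some cover, which gives one inequality.  The other needs that an ideal
    generated by [u] variables has height at most [u].  This follows from the
    fact that chains of primes in [n] variables have length at most [n]
    ([prime_chain_length]): elements witnessing the strictness of the
    inclusions in the chain are algebraically independent, and a count of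
    monomials shows that there cannot be more than [n] of them. *)

Set Implicit Arguments.
Unset Strict Implicit.
Unset Printing Implicit Defensive.

Import Order.TTheory GRing.Theory Num.Theory.
Local Open Scope ring_scope.

(** * Hall's theorem *)

Section Hall.

Local Open Scope nat_scope.

Variables (T U : finType).

(** Rado's argument: as long as some [r a] has two elements, one of them can
    be deleted without violating Hall's condition, and once all the [r x] are
    singletons the condition makes them distinct.  The function [u0] only
    provides values outside [A]. *)
Lemma hall_marriage (u0 : T -> U) (A : {set T}) (r : T -> {set U}) :
  (forall X : {set T}, X \subset A -> #|X| <= #|\bigcup_(x in X) r x|) ->
  exists2 f : T -> U, {in A &, injective f} & {in A, forall x, f x \in r x}.
Proof.
have [N] := ubnP (\sum_(x in A) #|r x|).
elim: N r => // N IHN r ltN hall.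
have [/exists_inP[a aA r_a_gt1] | /exists_inPn all_le1] :=
    boolP [exists a in A, 1 < #|r a|]; last first.
  have r1 x : x \in A -> exists u, r x = [set u].
    move=> xA; apply/cards1P; rewrite eqn_leq.
    move: (all_le1 x xA); rewrite -leqNgt => -> /=.
    have := hall [set x]; rewrite sub1set xA cards1 big_set1; exact.
  exists (fun x => odflt (u0 x) [pick u in r x]) => [x y xA yA | x xA];
      last first.
    have [u ->] := r1 x xA.
    by case: pickP => [v | /(_ u)]; rewrite !inE ?eqxx // => /eqP->.
  have [[u ru] [v rv]] := (r1 x xA, r1 y yA); rewrite ru rv.
  case: pickP => [u' | /(_ u)]; rewrite !inE ?eqxx // => /eqP->.
  case: pickP => [v' | /(_ v)]; rewrite !inE ?eqxx // => /eqP-> /= uv.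
  apply/eqP; apply: contraT => neq_xy.
  have := hall [set x; y]; rewrite subUset !sub1set xA yA cards2 neq_xy /=.
  by rewrite bigcup_setU !big_set1 ru rv uv setUid cards1 => /(_ isT).
pose r' b x := if x == a then r a :\ b else r x.
pose N' b (X : {set T}) := \bigcup_(x in X) r' b x.
have sub_r' b x : r' b x \subset r x.
  by rewrite /r'; case: eqP => [->|_]; rewrite ?subD1set.
have sum_r' b : b \in r a -> \sum_(x in A) #|r' b x| < N.
  move=> b_ra; rewrite -ltnS; apply: leq_trans ltN.
  rewrite ltnS (bigD1 a) //= [X in _ < X](bigD1 a) //= /r' eqxx.
  rewrite (cardsD1 b (r a)) b_ra -addSn add1n leq_add2l.
  by apply: leq_sum => x /andP[_ /negPf->].
suff [b b_ra hall_b] : exists2 b, b \in r a &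
    forall X : {set T}, X \subset A -> #|X| <= #|N' b X|.
  have [f injf fP] := IHN _ (sum_r' b b_ra) hall_b.
  by exists f => // x xA; apply: (subsetP (sub_r' b x)); apply: fP.
have /card_gt1P[b1 [b2 [b1r b2r neq_b]]] := r_a_gt1.
pose ok b := [forall X : {set T}, (X \subset A) ==> (#|X| <= #|N' b X|)].
have okP b : ok b -> forall X : {set T}, X \subset A -> #|X| <= #|N' b X|.
  by move=> /forallP okb X XA; have /implyP/(_ XA) := okb X.
(* If deleting either b1 or b2 from r a breaks the condition, at X1 and X2
   respectively, then X1 and X2 contain a, and counting the neighbours of
   X1 :|: X2 and of (X1 :&: X2) :\ a contradicts the condition for r. *)
have [/okP ok1 | /forallPn[X1]] := boolP (ok b1); first by exists b1.
have [/okP ok2 | /forallPn[X2]] := boolP (ok b2); first by exists b2.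
rewrite !negb_imply -!ltnNge => /andP[X2A lt2] /andP[X1A lt1].
have aX b (X : {set T}) : X \subset A -> #|N' b X| < #|X| -> a \in X.
  move=> XA; apply: contraLR => aNX; rewrite -leqNgt.
  rewrite (leq_trans (hall X XA)) // subset_leq_card //.
  apply/bigcupsP => x xX; apply: (bigcup_max x) => //.
  by rewrite /r'; case: eqP xX aNX => // -> ->.
have [a1 a2] := (aX _ _ X1A lt1, aX _ _ X2A lt2).
have leU : #|X1 :|: X2| <= #|N' b1 X1 :|: N' b2 X2|.
  have /hall/leq_trans-> // : X1 :|: X2 \subset A by rewrite subUset X1A.
  apply/subset_leq_card/bigcupsP => x xX; apply/subsetP => u ux.
  have [xa | neq_xa] := eqVneq x a; last first.
    rewrite inE; case/setUP: xX => xX; apply/orP; [left | right].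
      by apply/bigcupP; exists x; rewrite // /r' (negPf neq_xa).
    by apply/bigcupP; exists x; rewrite // /r' (negPf neq_xa).
  rewrite inE; have [ub | ub] := eqVneq u b1.
    apply/orP; right; apply/bigcupP; exists a; rewrite // /r' eqxx.
    by rewrite !inE ub neq_b.
  apply/orP; left; apply/bigcupP; exists a; rewrite // /r' eqxx.
  by rewrite !inE ub -xa.
have leI : #|(X1 :&: X2) :\ a| <= #|N' b1 X1 :&: N' b2 X2|.
  have /hall/leq_trans-> // : (X1 :&: X2) :\ a \subset A.
    by rewrite (subset_trans (subsetDl _ _)) // subIset ?X1A.
  apply/subset_leq_card/bigcupsP => x; rewrite !inE => /and3P[neq_xa x1 x2].
  by rewrite subsetI; apply/andP; split; apply: (bigcup_max x) => //;
     rewrite /r' (negPf neq_xa).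
have aI : a \in X1 :&: X2 by rewrite inE a1.
have := cardsUI X1 X2; have := cardsUI (N' b1 X1) (N' b2 X2).
have := cardsD1 a (X1 :&: X2); rewrite aI.
lia.
Qed.
End Hall.

(** * Minimum vertex covers of a graph *)

Section VertexCovers.

Local Open Scope nat_scope.

Variable V : finType.
Implicit Types (E F : {set {set V}}) (C S T X Y e : {set V}) (u v x : V).

Definition vertex_cover E C := [forall e in E, C :&: e != set0].

Definition min_covers E c := [set C | vertex_cover E C & #|C| == c].

Definition neighbours E X := [set u | [exists x in X, [set x; u] \in E]].

(** For the edges of a graph this is the combinatorial form of the Taylor
    twist: the largest number of vertices that [l] edges can span. *)
Definition max_span E l :=
  \max_(F : {set {set V}} | (F \subset E) && (#|F| <= l)) #|cover F|.

Lemma vertex_coverP E C :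
  reflect (forall e, e \in E -> exists2 v, v \in C & v \in e)
          (vertex_cover E C).
Proof.
apply: (iffP forall_inP) => cov e /cov.
  by case/set0Pn => v; rewrite inE => /andP[]; exists v.
by case=> v vC ve; apply/set0Pn; exists v; rewrite inE vC.
Qed.

Lemma leq_max_span E F l :
  F \subset E -> #|F| <= l -> #|cover F| <= max_span E l.
Proof. by move=> FE Fl; apply: (leq_bigmax_cond F); rewrite FE. Qed.

Lemma max_spanS E F l : E \subset F -> max_span E l <= max_span F l.
Proof.
move=> EF; apply/bigmax_leqP => D /andP[DE Dl].
exact: leq_max_span (subset_trans DE EF) Dl.
Qed.

Lemma neighboursP E X u :
  reflect (exists2 x, x \in X & [set x; u] \in E) (u \in neighbours E X).
Proof. by rewrite inE; apply: exists_inP. Qed.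

Lemma neighboursS E X Y :
  X \subset Y -> neighbours E X \subset neighbours E Y.
Proof.
move=> /subsetP XY; apply/subsetP => u /neighboursP[x /XY xY xu].
by apply/neighboursP; exists x.
Qed.

Section MinimalCovers.

Variables (E : {set {set V}}) (c : nat).
Hypothesis edgeE : forall e, e \in E -> #|e| = 2.
Hypothesis coverE : forall C, vertex_cover E C -> c <= #|C|.

Let mc := min_covers E c.

Lemma edge_split e x : e \in E -> x \in e -> exists2 y, y != x & e = [set x; y].
Proof.
move=> /edgeE/eqP/cards2P[a [b [neq_ab ->]]]; rewrite !inE => /orP[]/eqP->.
  by exists b; rewrite // eq_sym.
by exists a; rewrite // setUC.
Qed.

Lemma neighbours_disjoint_cover C X :
  vertex_cover E C -> [disjoint X & C] -> neighbours E X \subset C.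
Proof.
move=> /vertex_coverP covC /pred0P dXC.
apply/subsetP => u /neighboursP[x xX /covC[v vC]].
rewrite !inE => /orP[]/eqP vE; last by rewrite -vE.
by have := dXC x; rewrite !inE xX -vE vC.
Qed.

(** Trading [Y] for its neighbours outside a minimum cover [T] gives another
    cover, which cannot be smaller than [T]. *)
Lemma exchange_cover T Y :
    T \in mc -> Y \subset T ->
    (forall x y, x \in Y -> y \in Y -> [set x; y] \notin E) ->
  #|Y| <= #|neighbours E Y :\: T|.
Proof.
rewrite inE => /andP[/vertex_coverP covT /eqP cT] YT indY.
pose T' := (T :\: Y) :|: (neighbours E Y :\: T).
have : vertex_cover E T'.
  apply/vertex_coverP => e eE; have [x xT xe] := covT e eE.
  have [xY | xNY] := boolP (x \in Y); last first.
    by exists x; rewrite // !inE xNY xT.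
  have [y _ def_e] := edge_split eE xe.
  have yNY : y \notin Y.
    by apply/negP => yY; have /negP[] := indY x y xY yY; rewrite -def_e.
  exists y; last by rewrite def_e !inE eqxx orbT.
  rewrite 2!inE yNY; have [//= | yNT] := boolP (y \in T).
  by rewrite inE yNT; apply/neighboursP; exists x; rewrite // -def_e.
move=> /coverE/leq_trans/(_ (leq_card_setU _ _).1).
have := cardsID Y T; rewrite (setIidPr YT) cT; lia.
Qed.

(** Hall's condition for an independent set [S] whose vertices all lie in some
    minimum cover.  If the minimum cover [T] contains a vertex of [X], the
    neighbours of [X :&: T] outside [T] are numerous by exchange, those of
    [X :\: T] lie inside [T] and are numerous by induction, and the two groups
    are disjoint. *)
Lemma hall_condition S X :
    (forall x y, x \in S -> y \in S -> [set x; y] \notin E) ->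
    S \subset \bigcup_(T in mc) T -> X \subset S ->
  #|X| <= #|neighbours E X|.
Proof.
move=> indS SW; have [m] := ubnP #|X|; elim: m X => // m IHm X ltXm XS.
have [->|[x xX]] := set_0Vmem X; first by rewrite cards0.
have /bigcupP[T Tmc xT] := subsetP SW x (subsetP XS x xX).
pose Y := X :&: T.
have leY : #|Y| <= #|neighbours E Y :\: T|.
  apply: exchange_cover; rewrite ?subsetIr // => a b.
  rewrite !inE => /andP[/(subsetP XS)aS _] /andP[/(subsetP XS)bS _].
  exact: indS.
have leD : #|X :\: T| <= #|neighbours E (X :\: T)|.
  apply: IHm; last by rewrite (subset_trans (subsetDl _ _)).
  have : 0 < #|Y| by apply/card_gt0P; exists x; rewrite inE xX.
  by have := cardsID T X; rewrite -/Y; lia.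
rewrite -(cardsID T X) -(cardsID T (neighbours E X)) addnC leq_add //.
  apply: leq_trans leD _; apply: subset_leq_card; rewrite subsetI.
  rewrite neighboursS ?subsetDl //=.
  apply: neighbours_disjoint_cover; first by move: Tmc; rewrite inE => /andP[].
  by rewrite disjoints_subset; apply/subsetP => y; rewrite !inE => /andP[].
by rewrite (leq_trans leY) // subset_leq_card // setSD // neighboursS ?subsetIl.
Qed.

(** Fix a minimum cover [C].  The vertices of other minimum covers lying
    outside [C] can be matched into [C]; the matching edges, together with one
    edge at each unmatched vertex of [C], are at most [c] edges and span every
    vertex of every minimum cover. *)
Lemma union_min_covers_le : #|\bigcup_(T in mc) T| <= max_span E c.
Proof.
set W := \bigcup_(T in mc) T.
have [mc0 | [C Cmc]] := set_0Vmem mc; first by rewrite /W mc0 big_set0 cards0.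
have /andP[covC /eqP cardC] : vertex_cover E C && (#|C| == c).
  by rewrite inE in Cmc.
pose S := W :\: C.
have dSC : [disjoint S & C].
  by rewrite disjoints_subset; apply/subsetP => y; rewrite !inE => /andP[].
have indS x y : x \in S -> y \in S -> [set x; y] \notin E.
  move=> xS yS; apply/negP => /(vertex_coverP _ _ covC)[v vC].
  have:= pred0P dSC v; rewrite /= vC andbT => vNS; rewrite !inE.
  by case/orP => /eqP vE; rewrite -vE vNS in xS yS.
have hallS X : X \subset S -> #|X| <= #|\bigcup_(x in X) neighbours E [set x]|.
  move=> XS; apply: (leq_trans (hall_condition indS (subsetDl _ _) XS)).
  apply/subset_leq_card/subsetP => u /neighboursP[x xX xu].
  by apply/bigcupP; exists x => //; apply/neighboursP; exists x; rewrite ?inE.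
have [f injf fP] := hall_marriage id hallS.
have fE x : x \in S -> [set x; f x] \in E.
  by move=> /fP/neighboursP[y]; rewrite inE => /eqP->.
have fC x : x \in S -> f x \in C.
  move=> xS; apply: (subsetP (neighbours_disjoint_cover covC dSC)).
  by apply/neighboursP; exists x; rewrite // fE.
(* The vertices of C that the matching leaves out. *)
pose D := C :\: f @: S.
have edge_at u : u \in C -> exists2 e, e \in E & u \in e.
  move=> uC; apply/exists_inP; apply: contraT => /exists_inPn noE.
  (* A vertex of C on no edge could be removed from the cover. *)
  have /coverE : vertex_cover E (C :\ u).
    apply/vertex_coverP => e eE.
    have [v vC ve] := vertex_coverP _ _ covC e eE; exists v => //.
    by rewrite !inE vC andbT; apply: contraNneq (noE e eE) => <-.
  by have := cardsD1 u C; rewrite uC; lia.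
pose g u := odflt set0 [pick e in E | u \in e].
have gP u : u \in C -> g u \in E /\ u \in g u.
  move=> uC; rewrite /g; case: pickP => [e /andP[] // | noE].
  by have [e eE ue] := edge_at u uC; have := noE e; rewrite eE ue.
pose F := [set [set x; f x] | x in S] :|: g @: D.
have FE : F \subset E.
  rewrite subUset; apply/andP; split; apply/subsetP => e /imsetP[x xS ->].
    exact: fE.
  by move: xS; rewrite inE => /andP[_ /gP[]].
have fSC : f @: S \subset C by apply/subsetP => _ /imsetP[x /fC xC ->].
have cardF : #|F| <= c.
  apply: leq_trans (leq_card_setU _ _).1 _.
  apply: (leq_trans (leq_add (leq_imset_card _ _) (leq_imset_card _ _))).
  by rewrite -(card_in_imset injf) -cardC -(cardsID (f @: S) C) (setIidPr fSC).
apply: leq_trans (leq_max_span FE cardF); apply/subset_leq_card/subsetP => w wW.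
apply/bigcupP; have [wC | wNC] := boolP (w \in C); last first.
  exists [set w; f w]; last by rewrite !inE eqxx.
  by apply/setUP; left; apply: imset_f; rewrite inE wNC.
have [/imsetP[x xS ->] | wND] := boolP (w \in f @: S).
  exists [set x; f x]; last by rewrite !inE eqxx orbT.
  by apply/setUP; left; apply: imset_f.
exists (g w); last by have [] := gP w wC.
by apply/setUP; right; apply: imset_f; rewrite inE wND.
Qed.

End MinimalCovers.

(** Double counting of the pairs of a minimum cover and one of its vertices:
    those through [v] inject, by removing [v], into the covers of size [c.-1]
    of the graph without [v], and at most [max_span E c] vertices lie in some
    minimum cover.  The hypothesis allows [c] to lie below the covering
    number, since deleting [v] may lower that number by less than one. *)
Theorem card_min_covers_le E c :
    (forall e, e \in E -> #|e| = 2) ->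
    (forall C, vertex_cover E C -> c <= #|C|) ->
  #|min_covers E c| * c`! <= \prod_(1 <= l < c.+1) max_span E l.
Proof.
elim: c E => [|c IHc] E edgeE coverE.
  rewrite big_geq // fact0 muln1.
  rewrite (leq_trans (subset_leq_card _) (eq_leq (cards1 set0))) //.
  by apply/subsetP => C; rewrite !inE cards_eq0 => /andP[].
pose Ev v := [set e in E | v \notin e].
have sub_Ev v : Ev v \subset E by apply/subsetP => e; rewrite inE => /andP[].
set W := \bigcup_(T in min_covers E c.+1) T.
have count_v v : #|[set C in min_covers E c.+1 | v \in C]| * c`! <=
                 \prod_(1 <= l < c.+1) max_span E l.
  have le_span : \prod_(1 <= l < c.+1) max_span (Ev v) l <=
                 \prod_(1 <= l < c.+1) max_span E l.
    by apply: leq_prod => l _; apply: max_spanS.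
  apply: leq_trans (leq_trans (IHc (Ev v) _ _) le_span); last first.
  - move=> C covC; have /coverE : vertex_cover E (v |: C).
      apply/vertex_coverP => e eE; have [ve | vNe] := boolP (v \in e).
        by exists v; rewrite ?setU11.
      have /(vertex_coverP _ _ covC)[u uC ue] : e \in Ev v by rewrite inE eE.
      by exists u; rewrite // inE uC orbT.
    by rewrite cardsU1; case: (v \notin C); lia.
  - by move=> e /(subsetP (sub_Ev v))/edgeE.
  rewrite leq_mul2r; apply/orP; right.
  rewrite -(@card_in_imset _ _ (fun C => C :\ v)); last first.
    move=> C D; rewrite !inE => /andP[_ vC] /andP[_ vD] eqCD.
    by rewrite -(setD1K vC) -(setD1K vD) eqCD.
  apply/subset_leq_card/subsetP => _ /imsetP[C + ->].
  rewrite !inE => /andP[/andP[covC /eqP cardC] vC].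
  have := cardsD1 v C; rewrite vC cardC add1n => /eqP; rewrite eqSS eq_sym => ->.
  rewrite andbT; apply/vertex_coverP => e; rewrite inE => /andP[eE vNe].
  have [u uC ue] := vertex_coverP _ _ covC e eE; exists u => //.
  by rewrite !inE uC andbT; apply: contraNneq vNe => <-.
have double_count : #|min_covers E c.+1| * c.+1 =
                    \sum_(v in W) #|[set C in min_covers E c.+1 | v \in C]|.
  rewrite -sum_nat_const.
  transitivity (\sum_(C in min_covers E c.+1) \sum_(v in W | v \in C) 1).
    apply: eq_bigr => C Cmc; rewrite sum1dep_card.
    have -> : [set v in W | v \in C] = C.
      apply/setP => v; rewrite inE andb_idl // => vC.
      by apply/bigcupP; exists C.
    by move: Cmc; rewrite inE => /andP[_ /eqP].
  rewrite (exchange_big_dep (fun v => v \in W)) /=; last by move=> C v _ /andP[].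
  apply: eq_bigr => v vW; rewrite -sum1dep_card.
  by apply: eq_bigl => C; rewrite vW.
rewrite factS mulnA double_count big_distrl /= big_nat_recr //= mulnC.
apply: leq_trans (leq_mul (union_min_covers_le edgeE coverE) (leqnn _)).
by rewrite -sum_nat_const; apply: leq_sum => v _; apply: count_v.
Qed.
End VertexCovers.

(** * Chains of prime ideals in a polynomial ring *)

Section LinearIndependence.

Lemma leq_card_free (k : fieldType) (I J : finType) (A : I -> J -> k) :
  (forall a : I -> k,
     (forall j, \sum_i a i * A i j = 0) -> forall i, a i = 0) ->
  (#|I| <= #|J|)%N.
Proof.
move=> freeA; pose M := \matrix_(i < #|I|, j < #|J|) A (enum_val i) (enum_val j).
suff /eqP <- : row_free M by apply: rank_leq_col.
rewrite -kermx_eq0; apply/rowV0P => v /sub_kermxP vM0; apply/rowP => i.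
rewrite mxE -[i]enum_valK; apply: (freeA (fun x => v 0 (enum_rank x))) => j.
have /rowP/(_ (enum_rank j)) := vM0; rewrite !mxE => vMj.
rewrite -[RHS]vMj (reindex (@enum_val I predT)) /=;
  last exact/onW_bij/enum_val_bij.
by apply: eq_bigr => r _; rewrite mxE enum_rankK enum_valK.
Qed.

End LinearIndependence.

Section Ideals.

Variables (A : comNzRingType) (Q : {pred A}).
Hypothesis idQ : idealr_closed Q.

Lemma ideal0 : 0 \in Q. Proof. by case: idQ. Qed.

Lemma idealD f g : f \in Q -> g \in Q -> f + g \in Q.
Proof. by case: idQ => _ _ clQ fQ gQ; rewrite -[f]mul1r clQ. Qed.

Lemma idealMl f g : g \in Q -> f * g \in Q.
Proof. by case: idQ => Q0 _ clQ gQ; rewrite -[_ * _]addr0 clQ. Qed.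

Lemma idealN f : f \in Q -> - f \in Q.
Proof. by move=> fQ; rewrite -mulN1r idealMl. Qed.

Lemma ideal_sum (I : Type) (r : seq I) (P : pred I) (F : I -> A) :
  (forall i, P i -> F i \in Q) -> \sum_(i <- r | P i) F i \in Q.
Proof. by apply: (big_ind (fun f => f \in Q)); [apply: ideal0 | apply: idealD]. Qed.

End Ideals.

Section Dimension.

Variables (k : fieldType) (n : nat).
Local Notation R := {mpoly k[n]}.
Implicit Types (Q : {pred R}) (f : R).

Definition free_mod Q (J : finType) (F : J -> R) : Prop :=
  forall a : J -> k, \sum_j a j *: F j \in Q -> forall j, a j = 0.

Lemma card_bmultinom_le d : (#|{: 'X_{1..n < d.+1}}| <= d.+1 ^ n)%N.
Proof.
pose ex (m : 'X_{1..n < d.+1}) := [ffun i : 'I_n => inord (m i) : 'I_d.+1].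
have ex_inj : injective ex.
  move=> m1 m2 /ffunP eq_ex; apply/eqP; rewrite bmeqP; apply/eqP/mnmP => i.
  have lt_d (m : 'X_{1..n < d.+1}) : (m i < d.+1)%N.
    apply: leq_ltn_trans (bmdeg m); rewrite mdegE (bigD1 i) //=; exact: leq_addr.
  by have := congr1 val (eq_ex i); rewrite !ffunE /= !inordK.
by have := leq_card ex ex_inj; rewrite card_ffun !card_ord.
Qed.

Lemma free_mod_card Q (J : finType) (F : J -> R) d :
  idealr_closed Q -> free_mod Q F -> (forall j, (msize (F j) <= d.+1)%N) ->
  (#|J| <= d.+1 ^ n)%N.
Proof.
move=> idQ freeF szF; apply: leq_trans (card_bmultinom_le d).
apply: (@leq_card_free k _ _ (fun j (m : 'X_{1..n < d.+1}) => (F j)@_m)) => a a0.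
apply: freeF; suff -> : \sum_j a j *: F j = 0 by apply: ideal0.
apply/mpolyP => m; rewrite mcoeff0 raddf_sum /=.
have [lt_m | ge_m] := ltnP (mdeg m) d.+1.
  by rewrite -[RHS](a0 (BMultinom lt_m)); apply: eq_bigr => j _; rewrite mcoeffZ.
apply: big1 => j _; rewrite mcoeffZ memN_msupp_eq0 ?mulr0 //.
by apply: msize_mdeg_ge; apply: leq_trans (szF j) ge_m.
Qed.

(** Take a relation between the [f ^+ i * F j] modulo [Q].  Modulo [Q'] only
    the terms with [i = 0] survive, so their coefficients vanish; the rest of
    the relation is divisible by [f], which can be cancelled because [Q] is
    prime, and one concludes by induction on [T]. *)
Lemma free_mod_powers Q Q' (J : finType) (F : J -> R) f T :
  prime_ideal Q -> idealr_closed Q' -> {subset Q <= Q'} ->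
  f \in Q' -> f \notin Q -> free_mod Q' F ->
  free_mod Q (fun p : 'I_T * J => f ^+ p.1 * F p.2).
Proof.
move=> [idQ primeQ] idQ' subQ fQ' fNQ freeF.
pose G (b : J -> k) := \sum_j b j *: F j.
suff free_pow (b : nat -> J -> k) :
    \sum_(i < T) f ^+ i * G (b i) \in Q ->
  forall i, (i < T)%N -> forall j, b i j = 0.
  move=> a aQ [i j].
  pose b i j := if insub i is Some i' then a (i', j) else 0.
  have bE (i' : 'I_T) j' : b i' j' = a (i', j') by rewrite /b valK.
  rewrite -bE; apply: free_pow => //; move: aQ; congr (_ \in Q).
  transitivity (\sum_(i' < T) \sum_j' a (i', j') *: (f ^+ i' * F j')).
    by rewrite pair_bigA; apply: eq_bigr => -[].
  apply: eq_bigr => i' _; rewrite mulr_sumr; apply: eq_bigr => j' _.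
  by rewrite bE -scalerAr.
elim: T b => // T IHT b; rewrite big_ord_recl expr0 mul1r => bQ.
have tailE : \sum_(i < T) f ^+ bump 0 i * G (b (bump 0 i)) =
             f * \sum_(i < T) f ^+ i * G (b i.+1).
  by rewrite mulr_sumr; apply: eq_bigr => i _; rewrite /bump add1n exprS mulrA.
have b0 j : b 0%N j = 0.
  apply: freeF; rewrite -/(G _).
  rewrite -[G _](addrK (\sum_(i < T) f ^+ bump 0 i * G (b (bump 0 i)))).
  apply: (idealD idQ'); first exact: subQ.
  by apply: (idealN idQ'); rewrite tailE mulrC (idealMl idQ').
case=> [_ //| i lti]; apply: (IHT (fun i => b i.+1)) => //.
move: bQ; rewrite {1}/G big1 => [|j _]; last by rewrite b0 scale0r.
by rewrite add0r tailE => /primeQ; rewrite (negPf fNQ).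
Qed.

(** Picking [f_i] in each [Q i.+1] outside [Q i], the [T ^ l] monomials in the
    [f_i] with exponents below [T] are independent, and their degrees grow at
    most linearly in [T]. *)
Lemma prime_chain_free l (Q : nat -> {pred R}) :
  prime_chain l Q -> exists s, forall T, exists (J : finType) (F : J -> R),
    [/\ #|J| = (T ^ l)%N, free_mod (Q 0%N) F
      & forall j, (msize (F j) <= (s * T).+1)%N].
Proof.
elim: l Q => [|l IHl] Q [primeQ ltQ].
  exists 0%N => T; exists unit, (fun=> 1); split; rewrite ?card_unit //.
    move=> a; rewrite (big_pred1 tt) => [aQ [] |]; last by case.
    have [[_ /negP Q1 _] _] := primeQ 0%N (leqnn _).
    apply/eqP; apply/negPn/negP => a0; apply: Q1.
    have [idQ _] := primeQ 0%N (leqnn _).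
    by rewrite -[1]scale1r -(mulVf a0) -scalerA -mul_mpolyC (idealMl idQ).
  by move=> _; rewrite msize1.
have [|s sP] := IHl (fun i => Q i.+1).
  by split=> i lti; [apply: primeQ | apply: ltQ].
have [subQ nsubQ] := ltQ 0%N isT.
have [f fQ1 fNQ0] : exists2 f, f \in Q 1%N & f \notin Q 0%N.
  apply: NNPP => no_f; apply: nsubQ => f fQ1; apply/negPn/negP => fNQ0.
  by apply: no_f; exists f.
exists (s + (msize f).-1)%N => T; have [J [F [cardJ freeF szF]]] := sP T.
exists ('I_T * J)%type, (fun p : 'I_T * J => f ^+ p.1 * F p.2); split.
- by rewrite card_prod card_ord cardJ expnS.
- have [idQ1 _] := primeQ 1%N isT.
  exact: free_mod_powers (primeQ _ _) idQ1 subQ fQ1 fNQ0 freeF.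
case=> i j /=.
have szX : (msize (f ^+ i) <= ((msize f).-1 * i).+1)%N.
  elim: (nat_of_ord i) => [|m IHm]; first by rewrite expr0 msize1.
  rewrite exprS; have [->|f0] := eqVneq f 0; first by rewrite mul0r msize0.
  have [->|fm0] := eqVneq (f ^+ m) 0; first by rewrite mulr0 msize0.
  rewrite msizeM // mulnS; move: IHm.
  by move: (msize f).-1 (mpolySpred mdeg f0) (msize _) => a -> b; lia.
have [->|fi0] := eqVneq (f ^+ i) 0; first by rewrite mul0r msize0.
have [->|Fj0] := eqVneq (F j) 0; first by rewrite mulr0 msize0.
rewrite msizeM // mulnDl; have := szF j.
have : ((msize f).-1 * i <= (msize f).-1 * T)%N by rewrite leq_mul2l ltnW ?orbT.
move: szX; move: (msize f).-1 (msize (f ^+ i)) (msize (F j)) => a b c.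
move: (a * i)%N (a * T)%N (s * T)%N => x y z; lia.
Qed.

(** A chain of length [l] yields [T ^ l] independent polynomials of degree
    [O(T)], which live in a space of dimension [O(T ^ n)]. *)
Theorem prime_chain_length l (Q : nat -> {pred R}) : prime_chain l Q -> (l <= n)%N.
Proof.
move=> chainQ; have [s sP] := prime_chain_free chainQ.
rewrite leqNgt; apply/negP => lt_nl.
(* Large enough for (s T + 1)^n <= (s + 1)^n T^n < T^(n + 1). *)
pose T := ((s.+1) ^ n).+1; have [J [F [cardJ freeF szF]]] := sP T.
have [[idQ _] _] : prime_ideal (Q 0%N) /\ True.
  by case: chainQ => /(_ 0%N (leq0n _)).
have := free_mod_card idQ freeF szF; rewrite cardJ leqNgt => /negP; apply.
apply: (@leq_trans (T ^ n.+1)); last by rewrite leq_pexp2l.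
apply: (@leq_ltn_trans (s.+1 ^ n * T ^ n)); last first.
  by rewrite expnS ltn_mul2r expn_gt0 /T ltnS leqnn.
rewrite -expnMn; have [->//|n_gt0] := posnP n.
by rewrite leq_exp2r // mulSn /T; lia.
Qed.
End Dimension.

(** * Ideals generated by variables *)

Section VariableIdeals.

Variables (k : fieldType) (n : nat).
Local Notation R := {mpoly k[n]}.
Implicit Types (I P Q : {pred R}) (f : R) (U W : {set 'I_n}).

Definition kill U : n.-tuple R := [tuple if i \in U then 0 else 'X_i | i < n].

(** The prime ideal generated by the variables in [U], as the kernel of the
    substitution [kill U]; this form makes membership decidable and primality
    immediate. *)
Definition var_ideal U : {pred R} := [pred f | f \mPo kill U == 0].

Definition meets U (m : 'X_{1..n}) := [exists i in U, m i != 0%N].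

Lemma killX U m : 'X_[m] \mPo kill U = if meets U m then 0 else 'X_[m].
Proof.
rewrite comp_mpolyX; case: ifPn => [/exists_inP[i iU mi] | /exists_inPn Um].
  by rewrite (bigD1 i) //= tnth_mktuple iU expr0n (negPf mi) mul0r.
rewrite [RHS]mpolyXE_id; apply: eq_bigr => i _; rewrite tnth_mktuple.
by case: ifPn => // /Um; rewrite negbK => /eqP->.
Qed.

Lemma mem_var_idealX U m : ('X_[m] \in var_ideal U) = meets U m.
Proof.
rewrite inE killX; case: ifP => _; first by rewrite eqxx.
by rewrite -msize_poly_eq0 msizeX.
Qed.

Lemma var_ideal_prime U : prime_ideal (var_ideal U).
Proof.
split; first split; rewrite ?inE ?rmorph0 // ?rmorph1 ?oner_eq0 //.
  move=> f g h; rewrite !inE rmorphD rmorphM /= => /eqP-> /eqP->.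
  by rewrite mulr0 addr0.
by move=> f g; rewrite !inE rmorphM mulf_eq0.
Qed.

Lemma var_ideal_min U Q :
  idealr_closed Q -> (forall i, i \in U -> 'X_i \in Q) ->
  {subset var_ideal U <= Q}.
Proof.
move=> idQ UQ f; rewrite inE => /eqP f0.
suff : f - (f \mPo kill U) \in Q by rewrite f0 subr0.
have -> : f - (f \mPo kill U) =
    \sum_(m <- msupp f) f@_m *: ('X_[m] - ('X_[m] \mPo kill U)).
  under eq_bigr do rewrite scalerBr -comp_mpolyZ.
  by rewrite sumrB -raddf_sum -mpolyE.
apply: (ideal_sum idQ) => m _; rewrite -mul_mpolyC.
apply: (idealMl idQ); rewrite killX.
case: ifPn => [/exists_inP[i iU] | _]; last by rewrite subrr (ideal0 idQ).
by rewrite -lep1mP subr0 => /submK <-; rewrite mpolyXD (idealMl idQ) ?UQ.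
Qed.

Lemma mem_var_idealU U i : ('X_i \in var_ideal U) = (i \in U).
Proof.
rewrite mem_var_idealX; apply/exists_inP/idP => [[j jU] | iU].
  by rewrite mnm1E; case: (i =P j) => [->|].
by exists i; rewrite // mnm1E eqxx.
Qed.

Lemma var_idealS U W : U \subset W -> {subset var_ideal U <= var_ideal W}.
Proof.
move=> /subsetP UW; apply: var_ideal_min; first by case: (var_ideal_prime W).
by move=> i /UW iW; rewrite mem_var_idealU.
Qed.

(** The ideals generated by these sets climb from [U] to [W] one variable at a
    time; such chains bound dimensions and heights from below. *)
Definition flag U W i : {set 'I_n} := U :|: [set x in take i (enum (W :\: U))].

Lemma flag0 U W : flag U W 0 = U.
Proof. by rewrite /flag take0 set_nil setU0. Qed.

Lemma flag_last U W : U \subset W -> flag U W #|W :\: U| = W.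
Proof.
move=> UW; rewrite /flag take_oversize ?cardE // set_enum.
by rewrite -[RHS](setID W U) (setIidPr UW).
Qed.

Lemma flag_chain U W : prime_chain #|W :\: U| (fun i => var_ideal (flag U W i)).
Proof.
split=> i lti; first exact: var_ideal_prime.
have szE : size (enum (W :\: U)) = #|W :\: U| by rewrite cardE.
split.
  apply: var_idealS; apply: setUS; apply/subsetP => x; rewrite !inE.
  by rewrite -(take_takel _ (leqnSn i)) => /mem_take.
have /card_gt0P[x0 _] : (0 < #|W :\: U|)%N by apply: leq_ltn_trans lti.
pose x := nth x0 (enum (W :\: U)) i => subQ.
have xW : x \in W :\: U by rewrite -mem_enum mem_nth // szE.
have /subQ : 'X_x \in var_ideal (flag U W i.+1).
  rewrite mem_var_idealU !inE (take_nth x0) ?szE // mem_rcons inE eqxx.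
  by rewrite orbT.
rewrite mem_var_idealU !inE; move: xW; rewrite inE => /andP[/negPf-> _] /=.
by rewrite in_take ?mem_nth ?szE // index_uniq ?enum_uniq ?szE // ltnn.
Qed.

Lemma flag_chain0 U : prime_chain #|U| (fun i => var_ideal (flag set0 U i)).
Proof.
have <- : #|U :\: set0| = #|U| by rewrite setD0.
exact: flag_chain.
Qed.

Lemma flag0_last U : flag set0 U #|U| = U.
Proof.
have <- : #|U :\: set0| = #|U| by rewrite setD0.
exact: flag_last (sub0set U).
Qed.

Lemma leq_dim_above U I d :
  {subset I <= var_ideal U} -> krull_dim_quotient I d -> (n - #|U| <= d)%N.
Proof.
move=> IU [_ maxd]; rewrite -{1}(card_ord n) -cardsT -(setIidPr (subsetT U)) -cardsD.
by apply: (maxd _ _ (flag_chain U setT)); rewrite flag0.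
Qed.

(** A chain of primes ending at [var_ideal U] extends by the [n - #|U|] steps
    from [U] to the set of all variables, so the bound on the length of chains
    applies. *)
Lemma prime_height_var_ideal U : prime_height (var_ideal U) #|U|.
Proof.
split.
  exists (fun i => var_ideal (flag set0 U i)).
  by split; [apply: flag_chain0 | rewrite flag0_last].
move=> l Q [primeQ ltQ] QlU.
pose Q' i := if (i <= l)%N then Q i else var_ideal (flag U setT (i - l)).
have [_ ltF] := flag_chain U setT.
have /prime_chain_length : prime_chain (l + #|setT :\: U|) Q'.
  split=> i lti; rewrite /Q'.
    by case: ifP => [/primeQ //|_]; apply: var_ideal_prime.
  have [lt_il | ge_il] := ltnP i l; first by rewrite ltnW //; apply: ltQ.
  rewrite (subSn ge_il); have lt_i : (i - l < #|setT :\: U|)%N by lia.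
  case: (leqP i l) => [le_il | _]; last exact: ltF lt_i.
  have eq_il : i = l by apply/eqP; rewrite eqn_leq le_il.
  have:= ltF _ lt_i; rewrite eq_il subnn flag0 => -[subF nsubF].
  split=> [f | subQ]; first by rewrite QlU; exact: subF.
  by apply: nsubF => f /subQ; rewrite QlU.
have := cardsID U [set: 'I_n]; rewrite cardsT card_ord (setIidPr (subsetT U)); lia.
Qed.

Lemma ideal_height_le U I c :
  {subset I <= var_ideal U} -> ideal_height I c -> (c <= #|U|)%N.
Proof.
move=> IU [_ minc].
exact: minc (var_ideal_prime U) IU (prime_height_var_ideal U).
Qed.

(** The flag of ideals generated by variables of [U], with its top member
    replaced by [P]. *)
Lemma prime_height_ge P h U :
  prime_ideal P -> prime_height P h -> (forall i, i \in U -> 'X_i \in P) ->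
  (#|U| <= h)%N.
Proof.
move=> primeP [_ maxh] UP.
pose Q i := if (i < #|U|)%N then var_ideal (flag set0 U i) else P.
apply: (maxh _ Q); last by rewrite /Q ltnn.
have [primeF ltF] := flag_chain0 U.
split=> i lti; rewrite /Q; first case: ifP => _.
- exact: var_ideal_prime.
- exact: primeP.
rewrite lti; have [lt_iU | ge_iU] := ltnP i.+1 #|U|; first exact: ltF.
have subP : {subset var_ideal U <= P} by apply: var_ideal_min => //; case: primeP.
have flU : flag set0 U i.+1 = U.
  by rewrite (_ : i.+1 = #|U|) ?flag0_last //; apply/eqP; rewrite eqn_leq lti.
have [subF nsubF] := ltF i lti; rewrite flU in subF nsubF.
split=> [f fF | PF]; first exact: subP (subF f fF).
by apply: nsubF => f fU; exact: PF (subP f fU).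
Qed.

End VariableIdeals.

(** * Monomial ideals and the Hilbert-Samuel function *)

Section GeneratedIdeals.

Variables (A : comNzRingType).
Implicit Types (G : A -> Prop) (f g : A).

Lemma gen_ideal0 G : gen_ideal G 0.
Proof. by exists [::]; split=> //; rewrite big_nil. Qed.

Lemma gen_idealD G f g : gen_ideal G f -> gen_ideal G g -> gen_ideal G (f + g).
Proof.
move=> [s [sG ->]] [t [tG ->]]; exists (s ++ t); rewrite big_cat; split=> // p.
by rewrite mem_cat => /orP[/sG | /tG].
Qed.

Lemma gen_idealMl G f g : gen_ideal G g -> gen_ideal G (f * g).
Proof.
move=> [s [sG ->]]; exists [seq (f * p.1, p.2) | p <- s]; split.
  by move=> _ /mapP[p /sG pG ->].
by rewrite big_map mulr_sumr; apply: eq_bigr => p _; rewrite mulrA.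
Qed.

Lemma mem_gen_ideal G g : G g -> gen_ideal G g.
Proof.
move=> Gg; exists [:: (1, g)]; rewrite big_seq1 mul1r; split=> // p.
by rewrite inE => /eqP->.
Qed.

Lemma gen_ideal_sub G G' f :
  (forall g, G g -> gen_ideal G' g) -> gen_ideal G f -> gen_ideal G' f.
Proof.
move=> GG' [s [sG ->]]; rewrite big_seq.
apply: (big_ind (gen_ideal G')); [exact: gen_ideal0 | exact: gen_idealD |].
by move=> p /sG/GG'; apply: gen_idealMl.
Qed.

End GeneratedIdeals.

Section HilbertSamuel.

Variables (k : fieldType) (n : nat).
Local Notation R := {mpoly k[n]}.
Implicit Types (f : R) (m : 'X_{1..n}).

Section QuotientDim.

Variable J : R -> Prop.
Hypotheses (J0 : J 0) (JD : forall f g, J f -> J g -> J (f + g))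
  (JM : forall f g, J g -> J (f * g)).

(** If a basis had more than [#|B|] elements, expressing them through [b] would
    give a nontrivial linear relation between them modulo [J]. *)
Lemma quotient_dim_le h (B : finType) (b : B -> R) :
  (forall f, exists c : B -> k, J (f - \sum_i c i *: b i)) ->
  quotient_dim J h -> (h <= #|B|)%N.
Proof.
move=> spanB [b' basis]; rewrite -(card_ord h).
have Jsum (I : finType) (F : I -> R) : (forall i, J (F i)) -> J (\sum_i F i).
  by move=> JF; apply: (big_ind J) => // f g; apply: JD.
have [M MP] := fin_all_exists (fun i => spanB (b' i)).
apply: (leq_card_free (A := M)) => a a0 i.
have Jab : J (\sum_i a i *: b' i).
  have -> : \sum_i a i *: b' i = \sum_i a i *: (b' i - \sum_j M i j *: b j).
    under [RHS]eq_bigr do rewrite scalerBr scaler_sumr.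
    rewrite sumrB exchange_big [X in _ - X]big1 ?subr0 // => j _.
    under eq_bigr do rewrite scalerA.
    by rewrite -scaler_suml a0 scale0r.
  by apply: Jsum => j; rewrite -mul_mpolyC; apply: JM.
have [c [_ uniq_c]] := basis 0.
have c0 : c = [ffun=> 0].
  by apply: uniq_c; rewrite big1 ?subr0 // => j _; rewrite ffunE scale0r.
have ca : c = [ffun j => - a j].
  apply: uniq_c; rewrite sub0r -sumrN; move: Jab; congr (J _).
  by apply: eq_bigr => j _; rewrite ffunE scaleNr opprK.
move/ffunP/(_ i): ca; rewrite c0 !ffunE => /esym/eqP.
by rewrite oppr_eq0 => /eqP.
Qed.

End QuotientDim.

Lemma mpolyX_pow_irrelevant t m :
  (t <= mdeg m)%N -> pow_ideal (@irrelevant_ideal k n) t 'X_[m].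
Proof.
move=> le_tm.
suff [g [q [irr_g ->]]] : exists (g : nat -> R) q,
    (forall i, irrelevant_ideal (g i)) /\ 'X_[m] = q * \prod_(i < t) g i.
  by apply/gen_idealMl/mem_gen_ideal; exists g.
elim: t m le_tm => [|t IHt] m le_tm.
  exists (fun=> 0), 'X_[m]; rewrite big_ord0 mulr1; split=> // _.
  exact: gen_ideal0.
have [i mi] : exists i, m i != 0%N.
  apply/existsP; apply: contraTT le_tm => /existsPn m0.
  by rewrite -ltnNge mdegE big1 // => i _; apply/eqP; rewrite -[_ == _]negbK.
have def_m : (m - U_(i) + U_(i) = m)%MM by rewrite submK // lep1mP.
have [|g [q [irr_g mE]]] := IHt (m - U_(i))%MM.
  by move: le_tm; rewrite -{1}def_m mdegD mdeg1 addn1 ltnS.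
exists (fun j => if j is j'.+1 then g j' else 'X_i), q; split.
  by case=> //; apply: mem_gen_ideal; exists i.
by rewrite big_ord_recl -def_m mpolyXD mE mulrC mulrCA.
Qed.

Lemma hilbert_samuel_le (I : {pred R}) (G : seq 'X_{1..n}) t h :
  generated_by_monomials I G -> hilbert_samuel I t h ->
  (h <= #|[pred m : 'X_{1..n < t} | ~~ has (fun g => (g <= m)%MM) G]|)%N.
Proof.
move=> genI; set std := [pred m : 'X_{1..n < t} | _].
have I0 : 0 \in I by apply/genI/gen_ideal0.
have ID f g : f \in I -> g \in I -> f + g \in I.
  by move=> /genI If /genI Ig; apply/genI/gen_idealD.
have IM f g : g \in I -> f * g \in I.
  by move=> /genI Ig; apply/genI/gen_idealMl.
rewrite /hilbert_samuel; set J := add_ideal _ _.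
have JD f g : J f -> J g -> J (f + g).
  move=> [f1 [f2 [If1 Jf2 ->]]] [g1 [g2 [Ig1 Jg2 ->]]].
  exists (f1 + g1), (f2 + g2); rewrite addrACA ID //; split=> //.
  exact: gen_idealD.
have JM f g : J g -> J (f * g).
  move=> [g1 [g2 [Ig1 Jg2 ->]]]; exists (f * g1), (f * g2).
  by rewrite mulrDr IM //; split=> //; apply: gen_idealMl.
have J0 : J 0 by exists 0, 0; rewrite addr0 I0; split=> //; apply: gen_ideal0.
have -> : #|std| = #|{: {m | std m}}| by rewrite card_sig.
apply: (@quotient_dim_le J _ _ _ _ _ (fun m : {m | std m} => 'X_[val m])) => //.
elim/mpolyind => [|c m f _ _ [b Jb]].
  by exists (fun=> 0); rewrite sub0r big1 ?oppr0 // => m _; rewrite scale0r.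
suff [d Jd] : exists d : {m | std m} -> k, J ('X_[m] - \sum_i d i *: 'X_[val i]).
  exists (fun i => c * d i + b i).
  have -> : c *: 'X_[m] + f - \sum_i (c * d i + b i) *: 'X_[val i] =
      c%:MP * ('X_[m] - \sum_i d i *: 'X_[val i]) + (f - \sum_i b i *: 'X_[val i]).
    rewrite mul_mpolyC scalerBr scaler_sumr addrACA -opprD -big_split /=.
    by congr (_ - _); apply: eq_bigr => i _; rewrite scalerDl scalerA.
  by apply: JD => //; apply: JM.
have [lt_mt | ge_mt] := ltnP (mdeg m) t; last first.
  exists (fun=> 0); rewrite big1 => [|i _]; last by rewrite scale0r.
  rewrite subr0; exists 0, 'X_[m]; rewrite add0r I0; split=> //.
  exact: mpolyX_pow_irrelevant.
have [/hasP[g gG le_gm] | std_m] := boolP (has (fun g => (g <= m)%MM) G).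
  exists (fun=> 0); rewrite big1 => [|i _]; last by rewrite scale0r.
  rewrite subr0; exists 'X_[m], 0; rewrite addr0; split=> //.
    rewrite -(submK le_gm) mpolyXD; apply/genI/gen_idealMl/mem_gen_ideal.
    by exists g.
  exact: gen_ideal0.
have std_bm : std (BMultinom lt_mt) by [].
pose i0 : {m | std m} := Sub (BMultinom lt_mt) std_bm.
exists (fun i => (i == i0)%:R).
rewrite (bigD1 i0) //= eqxx scale1r big1 => [|i /negPf->]; last by rewrite scale0r.
by rewrite addr0 subrr.
Qed.

Lemma mem_monomial_gen_ideal (G : seq 'X_{1..n}) m :
  gen_ideal (fun g : R => exists2 m, m \in G & g = 'X_[m]) 'X_[m] ->
  exists2 g, g \in G & (g <= m)%MM.
Proof.
move=> [s [sG Xm]]; apply/hasP; apply: contraT => /hasPn noG.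
have : 'X_[m]@_m != 0 :> k by rewrite mcoeffX eqxx oner_eq0.
rewrite {1}Xm raddf_sum /= big_seq big1 ?eqxx // => p /sG[g gG ->].
apply: memN_msupp_eq0; rewrite (perm_mem (msuppMX _ _)).
by apply/mapP => -[m' _ mE]; have /negP[] := noG g gG; rewrite mE lem_addr.
Qed.

(** A minimal generator [m] is divisible by some [s] of [S], itself divisible
    by some [g] of [G]; if [g] were not [m], then [m] would be redundant. *)
Lemma minimal_generators_sub (I : {pred R}) (S G : seq 'X_{1..n}) :
  generated_by_monomials I S -> minimal_monomial_generators I G ->
  {subset G <= S}.
Proof.
move=> genS [_ genG minG] m mG.
have [s sS le_sm] : exists2 s, s \in S & (s <= m)%MM.
  apply: mem_monomial_gen_ideal; apply/genS/genG.
  by apply: mem_gen_ideal; exists m.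
have [g gG le_gs] : exists2 g, g \in G & (g <= s)%MM.
  apply: mem_monomial_gen_ideal; apply/genG/genS.
  by apply: mem_gen_ideal; exists s.
suff eq_gm : g = m.
  suff -> : m = s by [].
  apply/mnmP => i; apply/eqP; rewrite eqn_leq (mnm_lepP le_sm) andbT.
  by rewrite -eq_gm (mnm_lepP le_gs).
apply/eqP; apply: contraT => neq_gm.
pose G' := [seq g <- G | g != m].
have subG : {subset G' <= G} by move=> x; rewrite mem_filter => /andP[].
suff genG' : generated_by_monomials I G'.
  by have := minG G' subG genG' m mG; rewrite mem_filter eqxx.
move=> f; rewrite genG; split; apply: gen_ideal_sub => _ [a aG ->].
  have [-> | neq_am] := eqVneq a m; last first.
    by apply: mem_gen_ideal; exists a; rewrite // mem_filter neq_am.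
  rewrite -(submK (lepm_trans le_gs le_sm)) mpolyXD.
  by apply/gen_idealMl/mem_gen_ideal; exists g; rewrite // mem_filter neq_gm.
by apply: mem_gen_ideal; exists a => //; apply: subG.
Qed.

End HilbertSamuel.

(** * Polarization and standard monomials *)

Section Polarization.

Local Open Scope nat_scope.

Lemma extend_subset (T : finType) (A : {set T}) l :
  #|A| <= l -> l <= #|T| -> exists2 B : {set T}, A \subset B & #|B| = l.
Proof.
elim: l => [|l IHl] leAl leTl; first by exists A => //; apply/eqP; rewrite -leqn0.
have [ltAl | eqAl] := ltnP #|A| l.+1; last first.
  by exists A => //; apply/eqP; rewrite eqn_leq leAl.
have [B AB cardB] := IHl ltAl (ltnW leTl).
have /card_gt0P[x xNB] : 0 < #|~: B| by have := cardsC B; lia.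
exists (x |: B); first by rewrite (subset_trans AB) ?subsetUr.
by rewrite cardsU1 -in_setC xNB cardB.
Qed.


Variable n : nat.
Implicit Types (m g : 'X_{1..n}) (U : {set 'I_n}) (C : {set 'I_n * bool}).

(** The support of the polarization of [m]: [(i, false)] stands for [x_i] and
    [(i, true)] for the extra variable replacing the second factor of
    [x_i ^ 2].  As [b < m i] reads a boolean as 0 or 1, this keeps the degree
    as long as the exponents are at most 2. *)
Definition polarize m : {set 'I_n * bool} := [set p : 'I_n * bool | p.2 < m p.1].

Lemma card_polarize m : (forall i, m i <= 2) -> #|polarize m| = mdeg m.
Proof.
move=> m_le2; rewrite -sum1_card mdegE big_mkcond.
transitivity (\sum_i \sum_(b : bool) (b < m i : nat)).
  rewrite pair_bigA; apply: eq_bigr => p _; rewrite inE.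
  by case: ifP.
apply: eq_bigr => i _; rewrite big_bool /=.
by case: (m i) (m_le2 i) => [|[|[|]]].
Qed.

Lemma polarize_lcm (I : finType) (s : {set I}) (F : I -> 'X_{1..n}) :
  polarize (\big[@mlcm n/0%MM]_(i in s) F i) = \bigcup_(i in s) polarize (F i).
Proof.
apply: (big_morph polarize) => [m1 m2|]; apply/setP => p.
  by rewrite !inE mnmE leq_max.
by rewrite !inE mnmE.
Qed.

Variable G : seq 'X_{1..n}.
Hypothesis degG : forall g, g \in G -> mdeg g = 2.

Definition polar_edges : {set {set 'I_n * bool}} :=
  [set e in [seq polarize g | g <- G]].

Lemma polar_edgesP e :
  reflect (exists2 g, g \in G & e = polarize g) (e \in polar_edges).
Proof. by rewrite inE; apply: mapP. Qed.

Lemma leq_mdeg m i : m i <= mdeg m.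
Proof. by rewrite mdegE (bigD1 i) //= leq_addr. Qed.

Lemma card_polar_edge e : e \in polar_edges -> #|e| = 2.
Proof.
move=> /polar_edgesP[g gG ->]; rewrite card_polarize ?degG // => i.
by rewrite -(degG gG) leq_mdeg.
Qed.

(** Polarization turns lcms into unions of edges and degrees into
    cardinals.  A twist involves exactly [l] generators and a span at most [l]
    edges, whence the bound on [l]. *)
Lemma max_span_polar l :
  l <= size G -> max_span polar_edges l <= taylor_twist G l.
Proof.
move=> le_l; apply/bigmax_leqP => F /andP[FE Fl].
have [-> | [e0 e0F]] := set_0Vmem F; first by rewrite /cover big_set0 cards0.
have idxE e : e \in F -> exists i : 'I_(size G), e = polarize (nth 0%MM G i).
  move=> /(subsetP FE)/polar_edgesP[g gG ->].
  have lt_g : index g G < size G by rewrite index_mem.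
  by exists (Ordinal lt_g); rewrite //= nth_index.
have [i0 _] := idxE e0 e0F.
pose idx e := odflt i0 [pick i : 'I_(size G) | e == polarize (nth 0%MM G i)].
have idxP e : e \in F -> e = polarize (nth 0%MM G (idx e)).
  move=> /idxE[i eE]; rewrite /idx.
  by case: pickP => [j /eqP // | /(_ i)]; rewrite -eE eqxx.
have [s subs cards] : exists2 s : {set 'I_(size G)}, idx @: F \subset s & #|s| = l.
  by apply: extend_subset; rewrite ?card_ord // (leq_trans (leq_imset_card _ _)).
apply: leq_trans (leq_bigmax_cond s _); last by rewrite cards.
rewrite -card_polarize => [|v]; last first.
  elim/big_ind: _ => [|m1 m2|i _]; first by rewrite mnmE.
    by rewrite mnmE geq_max => -> ->.
  by rewrite -(degG (mem_nth 0%MM (ltn_ord i))) leq_mdeg.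
rewrite polarize_lcm; apply/subset_leq_card/bigcupsP => e eF.
rewrite (idxP e eF); apply: (bigcup_sup (idx e)).
by apply: (subsetP subs); apply: imset_f.
Qed.

Section Height.

Variable c : nat.
Hypothesis meetsG : forall U, (forall g, g \in G -> meets U g) -> c <= #|U|.

(** Forgetting the second component maps a cover of the polarized graph to a
    set of variables meeting every generator. *)
Lemma card_polar_cover C : vertex_cover polar_edges C -> c <= #|C|.
Proof.
move=> /vertex_coverP covC; apply: leq_trans (leq_imset_card fst C).
apply: meetsG => g gG; have [|v vC] := covC (polarize g).
  by apply/polar_edgesP; exists g.
rewrite inE => lt_v; apply/exists_inP; exists v.1; first exact: imset_f.
by rewrite -lt0n (leq_ltn_trans _ lt_v).
Qed.

Lemma cover_number_le_size : c <= size G.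
Proof.
pose var g : option 'I_n := [pick i | g i != 0].
apply: leq_trans (meetsG (U := [set i | Some i \in [seq var g | g <- G]]) _) _.
  move=> g gG; apply/exists_inP.
  have [i var_g] : exists i, var g = Some i.
    rewrite /var; case: pickP => [i _ | g0]; first by exists i.
    have := degG gG; rewrite mdegE big1 // => i _.
    exact/eqP/negbFE/g0.
  exists i; first by rewrite inE -var_g map_f.
  by move: var_g; rewrite /var; case: pickP => // j gj [<-].
rewrite -(card_imset _ (@Some_inj _)) -(size_map var).
apply: leq_trans (card_size _); apply/subset_leq_card/subsetP => _ /imsetP[i + ->].
by rewrite inE.
Qed.

End Height.

Definition square_var i := has (fun g => 1 < g i) G.

Definition standard m := ~~ has (fun g => (g <= m)%MM) G.

(** Attaches to a standard monomial a vertex cover of the polarized graph: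
    [(i, false)] when [x_i] does not occur in [m], [(i, true)] when it occurs
    but its exponent is bounded because [x_i ^ 2] is a generator.  The
    remaining variables are those whose exponent is unconstrained. *)
Definition cover_of m : {set 'I_n * bool} :=
  [set p : 'I_n * bool |
     if p.2 then (m p.1 != 0) && square_var p.1 else m p.1 == 0].

(** If a generator [g] does not divide [m], some exponent of [m] is smaller
    than that of [g]: it is 0, or it is 1 and [g] is a square. *)
Lemma cover_of_cover m : standard m -> vertex_cover polar_edges (cover_of m).
Proof.
move=> /hasPn std_m; apply/vertex_coverP => _ /polar_edgesP[g gG ->].
have [i lt_i] : exists i, m i < g i.
  apply/existsP; apply: contraT => /existsPn ge_i; have /negP[] := std_m g gG.
  by apply/mnm_lepP => i; rewrite leqNgt.
have g_le2 : g i <= 2 by rewrite -(degG gG) leq_mdeg.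
have [m0 | m_gt0] := eqVneq (m i) 0.
  by exists (i, false); rewrite inE /= ?m0 // -m0.
exists (i, true); rewrite inE /=; last by lia.
by rewrite m_gt0; apply/hasP; exists g => //; lia.
Qed.

Lemma standard_square m i : standard m -> square_var i -> m i <= 1.
Proof.
move=> /hasPn std_m /hasP[g gG gt1]; rewrite leqNgt; apply/negP => m_gt1.
have /negP[] := std_m g gG; apply/mnm_lepP => j.
have := degG gG; rewrite mdegE (bigD1 i) //=.
have [-> | neq_ji] := eqVneq j i; first by lia.
by rewrite (bigD1 j) //=; lia.
Qed.

Definition free_vars C := [set i | ((i, false) \notin C) && ((i, true) \notin C)].

Lemma card_free_vars m : #|free_vars (cover_of m)| + #|cover_of m| = n.
Proof.
rewrite -[RHS](card_ord n) -(cardsC (free_vars (cover_of m))).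
congr (_ + _); have -> : ~: free_vars (cover_of m) = fst @: cover_of m.
  apply/setP => i; rewrite !inE negb_and !negbK; apply/orP/imsetP.
    by case=> iC; [exists (i, false) | exists (i, true)]; rewrite // inE.
  by case=> -[j []] + -> /=; rewrite inE /= => ->; [right | left].
rewrite card_in_imset // => -[i b] [j b']; rewrite !inE /= => + + eq_ij.
rewrite -eq_ij; case: b b' => [] [] //=; first by move=> /andP[/negPf->].
by move=> ->.
Qed.

(** A standard monomial with given cover is determined by its exponents at the
    free variables, the others being 0 or 1. *)
Lemma card_standard_fibre N C :
  #|[set m : 'X_{1..n < N.+1} | standard m & cover_of m == C]| <=
    'C(#|free_vars C| + N, #|free_vars C|).
Proof.
set a := #|free_vars C|; rewrite -card_partial_ord_partitions.
pose ex (m : 'X_{1..n < N.+1}) : a.-tuple 'I_N.+1 :=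
  [tuple inord (m (enum_val j)) | j < a].
have lt_m (m : 'X_{1..n < N.+1}) i : m i < N.+1.
  exact: leq_ltn_trans (leq_mdeg m i) (bmdeg m).
rewrite -(@card_in_imset _ _ ex) => [|m1 m2]; last first.
  rewrite !inE => /andP[std1 /eqP cov1] /andP[std2 /eqP cov2] eq_ex.
  apply/eqP; rewrite bmeqP; apply/eqP/mnmP => i.
  have [free_i | ] := boolP (i \in free_vars C).
    have := congr1 (fun t => nat_of_ord (tnth t (enum_rank_in free_i i))) eq_ex.
    by rewrite /= !tnth_mktuple !inordK ?enum_rankK_in.
  rewrite inE negb_and !negbK => /orP[] iC.
    have := iC; rewrite -{1}cov1 inE /= => /eqP->.
    by have := iC; rewrite -{1}cov2 inE /= => /eqP->.
  have := iC; rewrite -{1}cov1 inE /= => /andP[m1i sq].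
  have := iC; rewrite -{1}cov2 inE /= => /andP[m2i _].
  by have := standard_square std1 sq; have := standard_square std2 sq; lia.
apply/subset_leq_card/subsetP => _ /imsetP[m _ ->]; rewrite inE.
rewrite big_tuple; under eq_bigr do rewrite tnth_mktuple inordK //.
rewrite -ltnS (leq_ltn_trans _ (bmdeg m)) //.
rewrite -(big_enum_val (A := mem (free_vars C)) (fun i => m i)) mdegE.
by rewrite [X in _ <= X](bigID (fun i => i \in free_vars C)) leq_addr.
Qed.

Lemma card_standard_le N :
  #|[pred m : 'X_{1..n < N.+1} | standard m]| <=
  \sum_(C | vertex_cover polar_edges C && (#|C| <= n)) 'C(n - #|C| + N, n - #|C|).
Proof.
rewrite -sum1_card (partition_big (fun m : 'X_{1..n < N.+1} => cover_of m)
  (fun C => vertex_cover polar_edges C && (#|C| <= n))) /=; last first.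
  move=> m std_m; rewrite cover_of_cover //=.
  by rewrite -[X in _ <= X](card_free_vars m) leq_addl.
apply: leq_sum => C _; rewrite sum1dep_card.
have [-> | [m0]] :=
    set_0Vmem [set m : 'X_{1..n < N.+1} | standard m & cover_of m == C].
  by rewrite cards0.
rewrite inE => /andP[_ /eqP eqC]; suff <- : #|free_vars C| = n - #|C|.
  exact: card_standard_fibre.
by have := card_free_vars m0; rewrite eqC; lia.
Qed.

End Polarization.

(** * The leading coefficient of the Hilbert-Samuel polynomial *)

Section RationalPolynomials.

Implicit Types p q r : {poly rat}.

(** The uniform lower bound [delta], rather than mere positivity, is what
    the induction on the degree needs. *)
Lemma poly_eventually_pos r :
  0 < lead_coef r ->
  exists2 delta, 0 < delta & exists N, forall t, (N <= t)%N -> delta <= r.[t%:R].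
Proof.
elim/poly_ind: r => [|r a IHr]; first by rewrite lead_coef0 ltxx.
have [-> | r0] := eqVneq r 0.
  rewrite mul0r add0r lead_coefC => a_gt0; exists a => //.
  by exists 0%N => t _; rewrite hornerC.
have lc : lead_coef (r * 'X + a%:P) = lead_coef r.
  rewrite lead_coefDl ?lead_coefMX // size_mulX // ltnS.
  by rewrite (leq_trans (size_polyC_leq1 _)) // size_poly_gt0.
rewrite lc => /IHr[delta delta_gt0 [N leN]].
(* Beyond N and |1 - a| / delta the value is at least
   delta * t + a >= 1. *)
exists 1 => //; exists (maxn N (Num.bound (`|1 - a| / delta))) => t.
rewrite geq_max => /andP[/leN le_delta le_t].
rewrite hornerMXaddC -lerBlDr.
have := archi_boundP (divr_ge0 (normr_ge0 (1 - a)) (ltW delta_gt0)).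
rewrite ltr_pdivrMr // => lt_b.
have le_t' : (Num.bound (`|1 - a| / delta))%:R <= t%:R :> rat by rewrite ler_nat.
rewrite (le_trans (ler_norm _)) // (le_trans (ltW lt_b)) //.
rewrite (le_trans (y := t%:R * delta)) //; first by rewrite ler_wpM2r // ltW.
by rewrite mulrC ler_wpM2r.
Qed.

Lemma lead_coef_ge0 r t0 :
  (forall t, (t0 <= t)%N -> 0 <= r.[t%:R]) -> 0 <= lead_coef r.
Proof.
move=> r_ge0; rewrite leNgt -oppr_gt0 -lead_coefN; apply/negP.
case/poly_eventually_pos => delta delta_gt0 [N leN].
have := leN _ (leq_maxl N t0); have := r_ge0 _ (leq_maxr N t0).
rewrite hornerN; lra.
Qed.

(** Being squeezed between 0 and [q] prevents [p] from having degree above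
    [d]; then [(q - p)`_d] is the leading coefficient of [q - p], or zero. *)
Lemma coef_le_of_eventually_le p q d t0 :
  (size q <= d.+1)%N ->
  (forall t, (t0 <= t)%N -> 0 <= p.[t%:R] <= q.[t%:R]) -> p`_d <= q`_d.
Proof.
move=> szq lepq.
have lc_p : 0 <= lead_coef p by apply: (lead_coef_ge0 (t0 := t0)) => t /lepq/andP[].
have lc_qp : 0 <= lead_coef (q - p).
  apply: (lead_coef_ge0 (t0 := t0)) => t /lepq/andP[_].
  by rewrite hornerD hornerN subr_ge0.
have szp : (size p <= d.+1)%N.
  rewrite leqNgt; apply/negP => lt_p; have lt_qp := leq_ltn_trans szq lt_p.
  move: lc_qp; rewrite lead_coefDr ?size_polyN // lead_coefN oppr_ge0 => lc_p'.
  have : lead_coef p == 0 by rewrite eq_le lc_p lc_p'.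
  by rewrite lead_coef_eq0 => /eqP p0; rewrite p0 size_poly0 in lt_p.
have szqp : (size (q - p)%R <= d.+1)%N.
  by rewrite (leq_trans (size_polyD _ _)) // geq_max szq size_polyN szp.
rewrite -subr_ge0 -coefB; move: szqp; rewrite leq_eqVlt => /orP[/eqP szE | lt_d].
  by move: lc_qp; rewrite lead_coefE szE.
by rewrite nth_default.
Qed.

(** A polynomial of degree [a] and leading coefficient [1 / a!] that dominates
    the number of monomials in [a] variables of degree less than its
    argument. *)
Definition binomial_bound a : {poly rat} := (a`!%:R)^-1 *: ('X + a%:R%:P) ^+ a.

Lemma size_binomial_bound a : size (binomial_bound a) = a.+1.
Proof.
rewrite size_scale ?invr_eq0 ?pnatr_eq0 -?lt0n ?fact_gt0 //.
by rewrite -[X in 'X + X]opprK -polyCN size_exp_XsubC.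
Qed.

Lemma binomial_bound_lead a : a`!%:R * (binomial_bound a)`_a = 1.
Proof.
rewrite coefZ mulrA divff ?pnatr_eq0 -?lt0n ?fact_gt0 // mul1r.
have := size_binomial_bound a.
rewrite size_scale ?invr_eq0 ?pnatr_eq0 -?lt0n ?fact_gt0 // => sz.
have : ('X + a%:R%:P) ^+ a \is @monic rat.
  by rewrite -[X in 'X + X]opprK -polyCN monic_exp // monicXsubC.
by move=> /monicP; rewrite lead_coefE sz.
Qed.

Lemma binomial_le_bound a N : 'C(a + N, a)%:R <= (binomial_bound a).[N.+1%:R].
Proof.
rewrite hornerZ horner_exp hornerD hornerX hornerC.
rewrite mulrC ler_pdivlMr ?ltr0n ?fact_gt0 // -natrM bin_ffact -natrD -natrX ler_nat.
apply: (@leq_trans ((a + N) ^ a)); last first.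
  by case: {2 4}a => // b; rewrite leq_exp2r //; lia.
elim: {2 4}a => // m IHm; by rewrite ffactnSr expnSr leq_mul // leq_subr.
Qed.
End RationalPolynomials.

Section Multiplicity.

Variables (k : fieldType) (n : nat).
Local Notation R := {mpoly k[n]}.

Lemma prime_ideal_var (P : {pred R}) (m : 'X_{1..n}) :
  prime_ideal P -> 'X_[m] \in P -> exists2 i, m i != 0%N & 'X_i \in P.
Proof.
move=> [[_ P1 _] primeP] mP; apply/exists_inP.
apply: contraLR mP => /exists_inPn noP.
have mulP f g : f \notin P -> g \notin P -> f * g \notin P.
  by move=> fP gP; apply/negP => /primeP; rewrite (negPf fP) (negPf gP).
rewrite mpolyXE_id; apply: (big_ind (fun f => f \notin P)) => // i _.
have [-> // | mi] := eqVneq (m i) 0%N.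
by elim: (m i) => // a IHa; rewrite exprS mulP // noP.
Qed.

Lemma ideal_sub_var_ideal (I : {pred R}) (G : seq 'X_{1..n}) (U : {set 'I_n}) :
  generated_by_monomials I G -> (forall g, g \in G -> meets U g) ->
  {subset I <= var_ideal U}.
Proof.
move=> genI GU f /genI[s [sG ->]]; have [idU _] := @var_ideal_prime k n U.
rewrite big_seq; apply: (ideal_sum idU) => p /sG[g gG ->].
by apply: (idealMl idU); rewrite mem_var_idealX GU.
Qed.

(** The Hilbert-Samuel function is bounded by the sum of [binomial_bound]
    over the covers [C], in degree [n - #|C|].  Only the covers of size [c]
    reach degree [n - c], each contributing [1 / (n - c)!] to that
    coefficient; if [d] exceeds [n - c] the coefficient is zero. *)
Lemma multiplicity_le_min_covers (I : {pred R}) (G : seq 'X_{1..n}) c d p t0 :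
  (forall g, g \in G -> mdeg g = 2%N) -> generated_by_monomials I G ->
  (forall U : {set 'I_n}, (forall g, g \in G -> meets U g) -> (c <= #|U|)%N) ->
  (n - c <= d)%N ->
  (forall t, (t0 <= t)%N ->
     exists2 h : nat, hilbert_samuel I t h & p.[t%:R] = h%:R) ->
  d`!%:R * p`_d <= #|min_covers (polar_edges G) c|%:R :> rat.
Proof.
move=> degG genI meetsG le_d hs; set E := polar_edges G.
pose q : {poly rat} :=
  \sum_(C | vertex_cover E C && (#|C| <= n)%N) binomial_bound (n - #|C|).
have covC C : vertex_cover E C -> (n - #|C| <= d)%N.
  by move=> /(card_polar_cover meetsG) le_c; apply: leq_trans le_d; apply: leq_sub2l.
have szq : (size q <= d.+1)%N.
  apply: leq_trans (size_sum _ _ _) _; apply/bigmax_leqP => C /andP[/covC le_C _].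
  by rewrite size_binomial_bound ltnS.
have le_pq : p`_d <= q`_d.
  apply: (@coef_le_of_eventually_le _ _ _ (maxn t0 1)) => // t.
  rewrite geq_max => /andP[/hs[h hsh ->] t_gt0]; rewrite ler0n /=.
  have := hilbert_samuel_le genI hsh; case: t t_gt0 {hsh} => // N _ le_h.
  apply: le_trans (_ : #|[pred m : 'X_{1..n < N.+1} | standard G m]|%:R <= _).
    by rewrite ler_nat.
  apply: le_trans (_ : (\sum_(C | vertex_cover E C && (#|C| <= n))
      'C(n - #|C| + N, n - #|C|))%N%:R <= _).
    by rewrite ler_nat card_standard_le.
  rewrite natr_sum horner_sum; apply: ler_sum => C _; exact: binomial_le_bound.
apply: le_trans (_ : d`!%:R * q`_d <= _); first by rewrite ler_wpM2l ?ler0n.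
rewrite coef_sum mulr_sumr -sum1_card natr_sum.
rewrite [leRHS](eq_bigl (fun C => vertex_cover E C && (#|C| == c))); last first.
  by move=> C; rewrite inE.
rewrite [leRHS]big_mkcondr [leLHS]big_mkcondr /=; apply: ler_sum => C covC'.
have le_c := card_polar_cover meetsG covC'.
case: ifP => [le_n | _]; last by case: ifP.
have [eq_d | neq_d] := eqVneq d (n - #|C|)%N.
  rewrite eq_d binomial_bound_lead; suff -> : #|C| == c by [].
  by apply/eqP; move: le_c le_n le_d; rewrite eq_d; move: #|C| => x; lia.
rewrite nth_default ?mulr0 ?size_binomial_bound; first by case: ifP.
by rewrite ltn_neqAle covC // andbT eq_sym.
Qed.

End Multiplicity.

(** * The Taylor bound *)

Theorem theorem1p1 (k : fieldType) (n : nat) (I : {pred {mpoly k[n]}})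
  (S : seq 'X_{1..n}) (deg_S : forall m, m \in S -> mdeg m = 2%N)
  (gen_I : generated_by_monomials I S)
  (G : seq 'X_{1..n}) (min_G : minimal_monomial_generators I G)
  (c : nat) (ht_I : ideal_height I c)
  (e : rat) (mult_I : hilbert_samuel_multiplicity I e) :
  e <= (\prod_(1 <= l < c.+1) taylor_twist G l)%:R / c`!%:R.
Proof.
have degG g : g \in G -> mdeg g = 2%N.
  by move=> /(minimal_generators_sub gen_I min_G)/deg_S.
have [_ genG _] := min_G.
have meetsG U : (forall g, g \in G -> meets U g) -> (c <= #|U|)%N.
  by move=> /(ideal_sub_var_ideal genG)/ideal_height_le; apply.
have [U GU le_Uc] : exists2 U : {set 'I_n},
    (forall g, g \in G -> meets U g) & (#|U| <= c)%N.
  have [[P [primeP IP htP]] _] := ht_I.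
  exists [set i | 'X_i \in P] => [g gG |]; last first.
    by apply: (prime_height_ge primeP htP) => i; rewrite inE.
  have /IP/(prime_ideal_var primeP)[i gi iP] : 'X_[g] \in I.
    by apply/genG/mem_gen_ideal; exists g.
  by apply/exists_inP; exists i; rewrite // inE.
have [d [p [dimI [t0 hs] ->]]] := mult_I.
have le_d : (n - c <= d)%N.
  by have := leq_dim_above (ideal_sub_var_ideal genG GU) dimI; lia.
apply: le_trans (multiplicity_le_min_covers degG genG meetsG le_d hs) _.
rewrite ler_pdivlMr ?ltr0n ?fact_gt0 // -natrM ler_nat.
apply: leq_trans (card_min_covers_le (card_polar_edge degG) _) _.
  exact: card_polar_cover.
rewrite !big_nat; apply: leq_prod => l /andP[_]; rewrite ltnS => le_lc.
by rewrite max_span_polar // (leq_trans le_lc) // cover_number_le_size.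
Qed.
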